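(* Let $\alpha\in\mathbb{R}$ with $\alpha\ne 2k\pi$ for all $k\in\mathbb{Z}$. For every integer $n\ge 2$, $$\sum_{k=-\infty}^{+\infty}\frac{1}{(2k\pi+\alpha)^n}=\frac{1}{2^n(n-1)!\,\sin^n(\alpha/2)}\sum_{l=1}^{n-1}\cos\big((n/2-l)\alpha\big)\,\overline{A}(n,l),$$ and for $n=1$, $$\lim_{N\to+\infty}\sum_{k=-N}^{N}\frac{1}{2k\pi+\alpha}=\frac12\cot\Big(\frac{\alpha}{2}\Big).$$
   Context: A circular $n$-permutation is an arrangement $\sigma=(\sigma(1),\dots,\sigma(n))$ of $\{1,\dots,n\}$ on a circle, considered up to rotation; with $\sigma(n+1)=\sigma(1)$, a descent of $\sigma$ is an entry $\sigma(i)$, $1\le i\le n$, with $\sigma(i)>\sigma(i+1)$. $\overline{A}(n,l)$ denotes the number of circular $n$-permutations with exactly $l$ descents. *)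

(* Defs.v *)
From mathcomp Require Import all_boot all_order all_algebra all_fingroup.

Set Implicit Arguments.
Unset Strict Implicit.
Unset Printing Implicit Defensive.

Local Open Scope group_scope.

(* Positions and values are numbered 0, ..., n-1 instead of 1, ..., n, which   *)
(* affects neither rotations nor descents.  [ordS] is the cyclic successor, so *)
(* that [s (ordS i)] is the entry following [s i] on the circle.               *)
Definition rot_perm n : 'S_n := perm (@ordS_inj n).

(* The product of permutations is applied from left to right:                  *)
(* [(rot_perm n ^+ k * s) i = s (i + k mod n)].  Hence the right coset         *)
(* [<[rot_perm n]> :* s] consists of exactly the rotations of the arrangement  *)
(* (s(0), ..., s(n-1)).                                                        *)
Definition circ_perms n : {set {set 'S_n}} := rcosets <[rot_perm n]> [set: 'S_n].

Definition cdes n (s : 'S_n) : nat := #|[set i | s (ordS i) < s i]|.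

Lemma cdes_rot n (s t : 'S_n) : t \in <[rot_perm n]> :* s -> cdes t = cdes s.
Proof.
case/rcosetP=> x /cycleP[k ->] ->; elim: k => [|k IHk]; first by rewrite mul1g.
rewrite -IHk expgS -mulgA; move: (_ * s) => u; rewrite /cdes.
rewrite -(card_imset _ (@ordS_inj n)); apply: eq_card => j; rewrite inE.
apply/imsetP/idP => [[i] | ltj].
  by rewrite inE !permM !permE => lti ->.
by exists (ord_pred j); rewrite ?inE ?permM ?permE ord_predK.
Qed.

(* By [cdes_rot], all the members of a class have the same number of descents. *)
Definition Abar (n l : nat) : nat :=
  #|[set C in circ_perms n | [forall s in C, cdes s == l]]|.

From mathcomp Require Import all_classical all_reals all_analysis.
Import GRing.Theory Num.Theory numFieldNormedType.Exports.
Local Open Scope classical_set_scope.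
Local Open Scope ring_scope.

(* The sum of f(k) over the integers -M <= k <= N.                             *)
Definition zpartial_sum (R : realType) (f : int -> R) (M N : nat) : R :=
  \sum_(0 <= j < (M + N).+1) f (j%:Z - M%:Z).

(* Convergence of the two-sided series of f to l: the lower and the upper      *)
(* bounds of summation tend to infinity independently of each other.           *)
Definition zseries_cvg (R : realType) (f : int -> R) (l : R) : Prop :=
  zpartial_sum f p.1 p.2 @[p --> filter_prod \oo \oo] --> l.

Definition cot (R : realType) (x : R) : R := cos x / sin x.

(* Main.v *)
Require Import Defs.
From mathcomp Require Import all_boot all_order all_algebra all_fingroup.
From mathcomp Require Import zify.

(* Inserting the largest entry into a circular arrangement leaves the number   *)
(* of descents unchanged when it is put in a descent and increases it by one   *)
(* otherwise, whence an Eulerian recurrence for [Abar].  This recurrence is    *)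
(* exactly what makes the right-hand sides P_n (with P_1 = cot(y/2)/2) satisfy *)
(* P_n' = - n P_(n+1).  Differentiating the duplication formula of the         *)
(* cotangent gives P_n(z) + P_n(z + pi) = 2^n P_n(2z), which iterates to       *)
(* P_n(a) = 2^(-mn) \sum_k P_n((a + 2 k pi) / 2^m), k over 2^m consecutive     *)
(* integers.  As m tends to infinity each term tends to (a + 2 k pi)^(-n), and *)
(* Tannery's theorem applies once the terms k and -k-1 are paired: the pairs   *)
(* are O(1/k^2) for n = 1 too.                                                 *)

(** * Circular permutations *)

(** Two properties of P_n = [cotsum (n-1)] carry the proof. Algebraically, P_n is (-1)^(n-1)/(n-1)!
    times the (n-1)-st derivative of cot(y/2)/2, by [is_derive_cotsum], which rests on the
    recurrence [AbarS]; so it inherits the duplication formula [cotsum_dup] and its iterate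
    [cotsum_distr_sym]. Analytically, P_n(h) is equivalent to h^(-n) at 0 ([cvg_cotsum0]), because
    the numbers [Abar n l] add up to (n-1)!; so each term of the iterate tends to a term of the
    lattice sum.

    [cotsum_pair_dominated] and [tannery_cst] then give the series with k and -k-1 paired, for every
    n >= 1 ([cvg_series_cotsum]). For n >= 2 the two halves also converge separately
    ([is_cvg_series_lattice]), so the bounds of summation may grow independently. For n = 1 the
    symmetric sum differs from a paired one by a single term that tends to 0. *)

Lemma rot_permX n (k : nat) (i : 'I_n.+1) :
  (rot_perm n.+1 ^+ k)%g i = inord ((i + k) %% n.+1).
Proof.
elim: k => [|k IHk]; apply/val_inj.
  by rewrite expg0 perm1 addn0 /= inordK ?modn_small ?ltn_mod.
rewrite expgSr permM IHk permE /= !inordK ?ltn_mod //.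
by rewrite -addn1 modnDml addn1 addnS.
Qed.

(** Rotations act freely and transitively on positions, so each class has exactly one representative
    with value [j] at position [i]. *)
Lemma Abar_card n l (i j : 'I_n.+1) :
  Abar n.+1 l = #|[set s : 'S_n.+1 | s i == j & cdes s == l]|.
Proof.
rewrite /Abar.
have inj : {in [set s : 'S_n.+1 | s i == j & cdes s == l] &,
   injective (fun s => <[rot_perm n.+1]> :* s)%g}.
  move=> s t; rewrite !inE => /andP[/eqP si _] /andP[/eqP ti _] eqst.
  have: s \in (<[rot_perm n.+1]> :* t)%g by rewrite -eqst rcoset_refl.
  case/rcosetP=> x /cycleP[k ->] def_s.
  have fixi : (rot_perm n.+1 ^+ k)%g i = i.
    by apply: (@perm_inj _ t); rewrite ti -[in RHS]si def_s permM.
  rewrite def_s; suff -> : (rot_perm n.+1 ^+ k = 1)%g by rewrite mul1g.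
  (* A rotation by [k] that fixes one position has [k] divisible by [n.+1], hence is the
     identity. *)
  have k0 : (n.+1 %| k)%N.
    move/(congr1 val): fixi; rewrite rot_permX /= inordK ?ltn_mod // => /eqP.
    have {2}-> : i = (i + 0) %% n.+1 :> nat by rewrite addn0 modn_small.
    by rewrite eqn_modDl mod0n.
  apply/permP=> a; apply/val_inj; rewrite rot_permX /= inordK ?ltn_mod // perm1.
  by rewrite -modnDmr (eqP k0) addn0 modn_small.
rewrite -(card_in_imset inj); apply: eq_card => C; rewrite inE.
apply/andP/imsetP => [[/rcosetsP[s _ ->] /forall_inP dC] | [s]].
  have [k def_k] : exists k, (rot_perm n.+1 ^+ k)%g i = (s^-1)%g j.
    exists (n.+1 - i + (s^-1)%g j)%N; apply/val_inj.
    rewrite rot_permX /= inordK ?ltn_mod // addnA subnKC 1?ltnW ?ltn_ord //.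
    by rewrite modnDl modn_small.
  have st : ((rot_perm n.+1 ^+ k)%g * s)%g \in (<[rot_perm n.+1]> :* s)%g.
    by rewrite mem_rcoset mulgK mem_cycle.
  exists ((rot_perm n.+1 ^+ k)%g * s)%g; last first.
    by apply/esym/rcoset_eqP.
  by rewrite inE permM def_k permKV eqxx dC.
rewrite inE => /andP[_ /eqP ds] ->; split.
  by apply/rcosetsP; exists s.
by apply/forall_inP=> t /cdes_rot->; rewrite ds.
Qed.

Lemma card_cdes n l :
  #|[set s : 'S_n.+1 | cdes s == l]| = (n.+1 * Abar n.+1 l)%N.
Proof.
rewrite -sum1_card (partition_big (fun s : 'S_n.+1 => s ord0) xpredT) //=.
rewrite (eq_bigr (fun=> Abar n.+1 l)).
  by rewrite sum_nat_const card_ord.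
move=> j _; rewrite (Abar_card n l ord0 j) -sum1_card; apply: eq_bigl => s.
by rewrite !inE andbC.
Qed.

Lemma cdes_sum n (s : 'S_n) : cdes s = (\sum_i (s (ordS i) < s i))%N.
Proof.
rewrite /cdes -sum1_card big_mkcond /=; apply: eq_bigr => i _; rewrite inE.
by case: ltnP.
Qed.

(** The new position [lift ord0 j] is the one right after [j]; opening it separates only [j] from
    its successor. It is never position 0, so the case [j = n] puts it last and needs no
    renumbering. *)
Lemma lift_ordS n (j k : 'I_n.+1) : k != j ->
  ordS (lift (lift ord0 j) k) = lift (lift ord0 j) (ordS k).
Proof.
move=> kj; apply/val_inj; move: kj; rewrite -val_eqE /= /bump /=.
move: (ltn_ord k) (ltn_ord j).
move: (nat_of_ord k) (nat_of_ord j) => a b la lb /eqP ab.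
have [an|ne] := eqVneq a n.
  have -> : (1 + b <= a) = true by lia.
  by rewrite an !add1n !modnn.
have E : a.+1 %% n.+1 = a.+1 by rewrite modn_small; lia.
rewrite E modn_small; case: (leqP (1 + b) a); case: (leqP (1 + b) a.+1); lia.
Qed.

(** The maximum is always a descent and its predecessor never is. The pair [j], [ordS j] is thus
    replaced by two pairs contributing exactly one descent, whatever it contributed before. *)
Lemma cdes_insert_max n (j : 'I_n.+1) (s : 'S_n.+1) :
  cdes (lift_perm (lift ord0 j) ord_max s) =
  (cdes s + ~~ (s (ordS j) < s j))%N.
Proof.
set t := lift_perm _ _ _.
have tmax : t (lift ord0 j) = ord_max by rewrite /t lift_perm_id.
have Sj : ordS (lift (lift ord0 j) j) = lift ord0 j.
  apply/val_inj; rewrite /= /bump /= add1n ltnn add0n modn_small //.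
  by rewrite ltnS ltn_ord.
rewrite !cdes_sum (bigD1_ord (lift ord0 j)) //= tmax.
rewrite (bigD1 j) //= [in RHS](bigD1 j) //= Sj tmax.
rewrite (eq_bigr (fun k => nat_of_bool (s (ordS k) < s k)%N)); last first.
  by move=> k kj; rewrite lift_ordS // /t !lift_perm_lift !lift_max.
have -> : (t (ordS (lift ord0 j)) < (ord_max : 'I_n.+2))%N.
  rewrite ltn_neqAle -ltnS ltn_ord andbT.
  rewrite -[nat_of_ord ord_max]/(val (@ord_max n.+1)).
  rewrite (inj_eq val_inj) -tmax (inj_eq perm_inj) -val_eqE /= /bump /= add1n.
  have [ej|ne] := eqVneq (j : nat) n; first by rewrite ej modnn.
  by rewrite modn_small ?eqn_leq ?ltnn //; move: (ltn_ord j); lia.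
have -> : ((ord_max : 'I_n.+2) < t (lift (lift ord0 j) j))%N = false.
  by apply/negbTE; rewrite -leqNgt -ltnS ltn_ord.
by rewrite /= add0n addnAC; case: ltnP.
Qed.

Lemma Abar_card_lift n l (i : 'I_n.+1) : 
  Abar n.+1 l = #|[set s : 'S_n | cdes (lift_perm i ord_max s) == l]|.
Proof.
rewrite (Abar_card n l i ord_max).
have inj : injective (fun s : 'S_n => lift_perm i ord_max s).
  move=> s t /permP eq; apply/permP=> k.
  by have := eq (lift i k); rewrite !lift_perm_lift => /lift_inj.
rewrite -(card_imset _ inj); apply: eq_card => t; rewrite inE.
apply/andP/imsetP => [[/eqP ti dt] | [s]].
  pose f (k : 'I_n) := odflt k (unlift ord_max (t (lift i k))).
  have fE k : lift ord_max (f k) = t (lift i k).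
    rewrite /f; case: unliftP => [k' -> //|].
    by rewrite -ti => /perm_inj /eqP; rewrite eq_sym (negPf (neq_lift _ _)).
  have f_inj : injective f.
    move=> a b /(congr1 (lift ord_max)); rewrite !fE => /perm_inj.
    exact: lift_inj.
  have def_t : t = lift_perm i ord_max (perm f_inj).
    apply/permP=> k; case: (unliftP i k) => [k' ->|->].
      by rewrite lift_perm_lift permE fE.
    by rewrite lift_perm_id.
  by exists (perm f_inj); rewrite ?inE -?def_t.
by rewrite inE => ds ->; rewrite lift_perm_id eqxx.
Qed.

(** Pairs made of an arrangement of [n.+1] entries and a gap for the new maximum are counted twice.
    Each gap alone produces all classes ([Abar_card_lift]), while an arrangement reaches [l]
    descents from its [l] descent gaps if it already has [l], and from its [n.+1 - l'] other gaps if
    it has [l'], one fewer. *)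
Lemma AbarS n l :
  Abar n.+2 l = (l * Abar n.+1 l +
    (if l is l'.+1 then (n.+1 - l') * Abar n.+1 l' else 0))%N.
Proof.
(* With the factor [n.+1] the sum runs over permutations instead of classes, see [card_cdes]. *)
apply/eqP; rewrite -(eqn_pmul2l (ltn0Sn n)).
have -> : (n.+1 * Abar n.+2 l)%N =
   (\sum_(s : 'S_n.+1) \sum_(j < n.+1) (cdes s + ~~ (s (ordS j) < s j) == l))%N.
  rewrite exchange_big /= -{1}(card_ord n.+1) -sum_nat_const.
  apply/eq_bigr => j _; rewrite (Abar_card_lift n.+1 l (lift ord0 j)).
  rewrite -sum1_card big_mkcond /=; apply: eq_bigr => s _.
  by rewrite inE cdes_insert_max; case: eqP.
have cS (s : 'S_n.+1) :
    (\sum_(j < n.+1) ~~ (s (ordS j) < s j) = n.+1 - cdes s)%N.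
  have def_n : (\sum_(j < n.+1) ~~ (s (ordS j) < s j) + cdes s = n.+1)%N.
    rewrite cdes_sum -big_split /= -[RHS](card_ord n.+1) -sum1_card.
    by apply: eq_bigr => j _; case: ltnP.
  by rewrite -[X in (X - _)%N]def_n addnK.
have -> : (\sum_(s : 'S_n.+1)
    \sum_(j < n.+1) (cdes s + ~~ (s (ordS j) < s j) == l) =
  \sum_(s : 'S_n.+1) ((cdes s == l) * l +
     (if l is l'.+1 then (cdes s == l') * (n.+1 - l') else 0)))%N.
  apply: eq_bigr => s _.
  have -> : ((cdes s == l) * l =
      \sum_(j < n.+1) (cdes s == l) * (s (ordS j) < s j))%N.
    by rewrite -big_distrr /= -cdes_sum; case: eqP => // ->.
  have -> : (if l is l'.+1 then (cdes s == l') * (n.+1 - l') else 0)%N =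
    (\sum_(j < n.+1) (cdes s + 1 == l) * ~~ (s (ordS j) < s j))%N.
    rewrite -big_distrr /= cS; case: l => [|l]; first by rewrite addn1.
    by rewrite addn1 eqSS; case: eqP => // ->.
  rewrite -big_split; apply: eq_bigr => j _ /=.
  by case: (s _ < s _)%N; rewrite /= ?addn0 ?muln1 ?muln0 ?addn0 ?add0n.
have sumE m : (\sum_(s : 'S_n.+1) (cdes s == m) = n.+1 * Abar n.+1 m)%N.
  rewrite -card_cdes -sum1_card [RHS]big_mkcond /=; apply: eq_bigr => s _.
  by rewrite inE; case: eqP.
rewrite big_split /= -big_distrl /= sumE mulnDr; apply/eqP; congr addn.
  by rewrite -mulnA (mulnC l).
case: l => [|l]; first by rewrite big1 ?muln0.
by rewrite -big_distrl /= sumE -mulnA [in RHS](mulnC (n.+1 - l)%N).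
Qed.

Lemma Abar1 l : Abar 1 l = (l == 0).
Proof.
rewrite (Abar_card 0 l ord0 ord0).
have c0 (s : 'S_1) : cdes s = 0.
  by rewrite cdes_sum big_ord1 !ord1 ltnn.
case: eqP => [->|/eqP l0].
  rewrite (eq_card (B := [set: 'S_1])) ?cardsT ?card_Sn // => s.
  by rewrite !inE c0 ord1 !eqxx.
apply/eqP; rewrite cards_eq0 -subset0; apply/fintype.subsetP=> s; rewrite !inE c0.
by rewrite (eq_sym 0 l) (negPf l0) andbF.
Qed.

Lemma Abar_eq0 n l : n < l -> Abar n.+1 l = 0.
Proof.
elim: n l => [|n IHn] [|l] // nl; first by rewrite Abar1.
by rewrite AbarS !IHn ?muln0 //; apply: ltnW.
Qed.

(** * Cotangent sums *)

From mathcomp Require Import all_classical all_reals all_analysis.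
From mathcomp Require Import ring lra.
Import Order.TTheory GRing.Theory Num.Theory numFieldNormedType.Exports.
Local Open Scope classical_set_scope.
Local Open Scope ring_scope.

(** The recurrence in transposed form, for arbitrary weights: constant weights give the total
    [sum_Abar], cosines give the derivative of [cotsum]. *)
Lemma sum_AbarS (R : comPzRingType) (F : nat -> R) n :
  \sum_(l < n.+2) F l * (Abar n.+2 l)%:R =
  \sum_(l < n.+1) (l%:R * F l + (n.+1%:R - l%:R) * F l.+1) * (Abar n.+1 l)%:R.
Proof.
rewrite big_ord_recl AbarS mul0n add0n mulr0 add0r.
transitivity (\sum_(l < n.+1) F l.+1 * (l.+1%:R * (Abar n.+1 l.+1)%:R) +
    \sum_(l < n.+1) F l.+1 * ((n.+1%:R - l%:R) * (Abar n.+1 l)%:R)).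
  rewrite -big_split; apply: eq_bigr => l _ /=.
  rewrite -mulrDr AbarS natrD !natrM natrB //.
  by rewrite ltnW.
have -> : \sum_(l < n.+1) F l.+1 * (l.+1%:R * (Abar n.+1 l.+1)%:R) =
          \sum_(l < n.+1) F l * (l%:R * (Abar n.+1 l)%:R).
  (* The shift of index is free: the term at 0 carries the factor 0, and the one at [n.+1] vanishes
     by [Abar_eq0]. *)
  transitivity (\sum_(l < n.+2) F l * (l%:R * (Abar n.+1 l)%:R)).
    by rewrite [RHS]big_ord_recl /= mul0r mulr0 add0r.
  by rewrite big_ord_recr /= Abar_eq0 // !mulr0 addr0.
by rewrite -big_split; apply: eq_bigr => l _ /=; ring.
Qed.

Lemma sum_Abar (R : comPzRingType) n :
  \sum_(l < n.+1) (Abar n.+1 l)%:R = n`!%:R :> R.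
Proof.
elim: n => [|n IHn]; first by rewrite big_ord1 Abar1.
have := @sum_AbarS R (fun=> 1) n; under eq_bigr do rewrite mul1r.
move=> ->; rewrite factS natrM -IHn mulr_sumr; apply: eq_bigr => l _.
by ring.
Qed.

(* The right-hand side of the theorem for the exponent [n.+1].  Starting the sum
   at [l = 0] adds a zero term, except for [n = 0], where it makes the formula
   yield [cot (y / 2) / 2]. *)
Definition cotsum {R : realType} n (y : R) : R :=
  1 / (2 ^+ n.+1 * n`!%:R * sin (y / 2) ^+ n.+1) *
  \sum_(l < n.+1) cos ((n.+1%:R / 2 - l%:R) * y) * (Abar n.+1 l)%:R.

Lemma cotsum0 (R : realType) (y : R) : cotsum 0 y = 1 / 2 * cot (y / 2).
Proof.
rewrite /cotsum big_ord1 Abar1 /cot !expr1 fact0.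
have -> : (1%:R / 2 - (0 : nat)%:R) * y = y / 2 by ring.
by rewrite eqxx !mulr1 !invfM; ring.
Qed.

Lemma is_derive_cotsum (R : realType) n (y : R) : sin (y / 2) != 0 ->
  is_derive y 1 (cotsum n) (- n.+1%:R * cotsum n.+1 y).
Proof.
move=> s0.
pose k (l : nat) : R := n.+1%:R / 2 - l%:R.
have dlin (c x : R) : is_derive x 1 (fun x => c * x) c.
  by apply: is_derive_eq; rewrite scaler1.
have dhalf : is_derive y 1 (fun x : R => sin (x / 2)) (cos (y / 2) / 2).
  have -> : (fun x : R => sin (x / 2)) = sin \o (fun x => 2^-1 * x).
    by apply/funext=> x /=; rewrite mulrC.
  rewrite [y / 2]mulrC; apply: is_derive1_comp.
have dS : is_derive y 1
    (\sum_(l < n.+1) (fun x : R => cos (k l * x) * (Abar n.+1 l)%:R))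
    (\sum_(l < n.+1) (- sin (k l * y) * k l) * (Abar n.+1 l)%:R).
  apply: is_derive_sum => l.
  have dc : is_derive y 1 (cos \o (fun x => k l * x)) (- sin (k l * y) * k l).
    exact: is_derive1_comp.
  have -> : (fun x : R => cos (k l * x) * (Abar n.+1 l)%:R) =
      (Abar n.+1 l)%:R \*: (cos \o (fun x => k l * x)).
    by apply/funext=> x; rewrite /= [RHS]mulrC.
  by apply: is_derive_eq; rewrite [LHS]mulrC.
set S := \sum_(l < n.+1) _ in dS; set dS' := \sum_(l < n.+1) _ in dS.
pose g x : R := (sin (x / 2))^-1.
have dg : is_derive y 1 g (- (sin (y / 2)) ^- 2 *: (cos (y / 2) / 2)).
  exact: is_deriveV.
pose c : R := 1 / (2 ^+ n.+1 * n`!%:R).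
have -> : cotsum n = c \*: (g ^+ n.+1 * S).
  apply/funext=> x; rewrite /cotsum /c /S /g /= fct_sumE.
  by rewrite mulrfctE exprfctE /= !div1r [in LHS]invfM exprVn -mulrA.
apply: is_derive_eq.
rewrite /cotsum (sum_AbarS _ (fun l => cos ((n.+2%:R / 2 - l%:R) * y))) /=.
set T := \sum_(l < n.+1) _.
(* The numerator of the derivative of S / sin^(n+1). With A = k l * y and B = y/2, it amounts to l
   cos(A+B) + (n+1-l) cos(A-B) = (n+1) cos A cos B + 2 (k l) sin A sin B, whose left side has the
   weights of [sum_AbarS]. *)
have key : sin (y / 2) * dS' - n.+1%:R * (cos (y / 2) / 2) * S y = - (1 / 2) * T.
  rewrite /S fct_sumE !mulr_sumr -sumrB; apply: eq_bigr => l _.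
  have -> : (n.+2%:R / 2 - l%:R) * y = k l * y + y / 2 by rewrite /k; field.
  have -> : (n.+2%:R / 2 - l.+1%:R) * y = k l * y - y / 2 by rewrite /k; field.
  by rewrite cosD cosB /k; field.
rewrite -[T](mulKf (x := - (1 / 2))) -?key; last by lra.
rewrite /GRing.scale /= exprfctE /g factS natrM /c !exprS exprVn.
move: (S y) dS' {key dS T dg c g} => Sy dSy.
have f0 : n`!%:R != 0 :> R by rewrite pnatr_eq0 -lt0n fact_gt0.
have n0 : n.+1%:R != 0 :> R by rewrite pnatr_eq0.
have p0 : 2 ^+ n != 0 :> R by rewrite expf_neq0 // pnatr_eq0.
have sn0 : sin (y / 2) ^+ n != 0 by rewrite expf_neq0.
move: n`!%:R (2 ^+ n) (sin (y / 2) ^+ n) f0 p0 sn0 => f p sn f0 p0 sn0.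
rewrite -mulNrn; field.
by rewrite sn0 s0 f0 nat1r n0 p0.
Qed.

Lemma sin_half_neq0 (R : realType) (z : R) : sin z != 0 ->
  sin (z / 2) != 0 /\ cos (z / 2) != 0.
Proof.
have {1}-> : z = z / 2 *+ 2 by rewrite -mulr_natr divfK.
by rewrite sin_mulr2n mulrn_eq0 mulf_eq0 !negb_or => /and3P[].
Qed.

(** For [n = 0] this is cot(z/2) - tan(z/2) = 2 cot z. The induction step differentiates both sides;
    the chain rule supplies the extra factor 2 on the right. *)
Lemma cotsum_dup (R : realType) n (z : R) : sin z != 0 ->
  cotsum n z + cotsum n (z + pi) = 2 ^+ n.+1 * cotsum n (2 * z).
Proof.
have sin_shift (x : R) : sin ((x + pi) / 2) = cos (x / 2).
  by rewrite mulrDl sinDpihalf.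
elim: n z => [|n IHn] z sz.
  have [s0 c0] := sin_half_neq0 _ _ sz.
  rewrite !cotsum0 /cot sin_shift mulrDl cosDpihalf.
  have -> : 2 * z / 2 = z / 2 *+ 2 by rewrite -mulr_natr; field.
  rewrite mulr2n cosD sinD -[in RHS](mulrC (cos _)).
  have d0 : sin (z / 2) * cos (z / 2) + cos (z / 2) * sin (z / 2) != 0.
    by rewrite -sinD -splitr.
  by field; rewrite d0 s0 c0.
have [s0 c0] := sin_half_neq0 _ _ sz.
have shift_deriv : is_derive z 1 (fun x : R => x + pi) 1.
  by apply: is_derive_eq; rewrite addr0.
have double_deriv : is_derive z 1 (fun x : R => 2 * x) 2.
  by apply: is_derive_eq; rewrite scaler1.
have d1 := is_derive_cotsum _ n _ s0.
have d2 : is_derive z 1 (cotsum n \o (fun x => x + pi))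
    (- n.+1%:R * cotsum n.+1 (z + pi) * 1).
  by apply: is_derive1_comp; apply: is_derive_cotsum; rewrite sin_shift.
have d3 : is_derive z 1 (cotsum n \o (fun x => 2 * x))
    (- n.+1%:R * cotsum n.+1 (2 * z) * 2).
  apply: is_derive1_comp; apply: is_derive_cotsum.
  by rewrite mulrC mulKf.
have dl : is_derive z 1 (cotsum n + (cotsum n \o (fun x => x + pi)))
    (- n.+1%:R * cotsum n.+1 z + - n.+1%:R * cotsum n.+1 (z + pi) * 1).
  exact: is_deriveD.
have dr : is_derive z 1 (2 ^+ n.+1 \*: (cotsum n \o (fun x => 2 * x)))
    (2 ^+ n.+1 *: (- n.+1%:R * cotsum n.+1 (2 * z) * 2)) by apply: is_derive_eq.
(* Comparing derivatives at [z] needs the identity on a neighbourhood, which holds since sin stays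
   nonzero there. *)
have near_eq : \near z, (cotsum n + (cotsum n \o (fun x => x + pi))) z =
    (2 ^+ n.+1 \*: (cotsum n \o (fun x => 2 * x))) z.
  near=> x; apply: IHn; near: x.
  exact: (cvgr_neq0 _ (@continuous_sin R z)).
have := @near_eq_is_derive _ _ _ _ _ _ _ _ near_eq dl.
move=> /@derive_val; rewrite (@derive_val _ _ _ _ _ _ _ dr) /GRing.scale /= => eqd.
apply: (@mulfI _ (- n.+1%:R)); first by rewrite oppr_eq0 pnatr_eq0.
rewrite mulrDr -[X in _ + X]mulr1 -eqd [in RHS]exprS; ring.
Unshelve. all: by end_near. Qed.

(** Each cosine and the power of the sine change by the same sign (-1)^(n+1). *)
Lemma cotsum_periodic (R : realType) n (y : R) :
  cotsum n (y + 2 * pi) = cotsum n y.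
Proof.
rewrite /cotsum.
have -> : (y + 2 * pi) / 2 = y / 2 + pi by field.
rewrite sinDpi exprNn.
have cE (l : nat) : cos ((n.+1%:R / 2 - l%:R) * (y + 2 * pi)) =
    (-1) ^+ n.+1 * cos ((n.+1%:R / 2 - l%:R) * y).
  rewrite -(alternatingn (@cosDpi R)) -[LHS](periodicn (@cosD2pi R) l).
  by congr cos; rewrite -[_ *+ l]mulr_natr -[_ *+ n.+1]mulr_natr; field.
under eq_bigr do rewrite cE -mulrA.
rewrite -mulr_sumr mulrA; congr (_ * _).
by rewrite !mul1r mulrCA invfM invr_sign mulrAC -expr2 sqrr_sign mul1r.
Qed.

Lemma sin_div2X_neq0 (R : realType) m (z : R) :
  sin z != 0 -> sin (z / 2 ^+ m) != 0.
Proof.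
move=> sz; elim: m => [|m IHm]; first by rewrite expr0 divr1.
by rewrite exprSr invfM mulrA; have [] := sin_half_neq0 _ _ IHm.
Qed.

Lemma cotsum_distr (R : realType) n m (y : R) : sin (y / 2) != 0 ->
  \sum_(0 <= k < 2 ^ m) cotsum n ((y + 2 * k%:R * pi) / 2 ^+ m) =
  (2 ^+ n.+1) ^+ m * cotsum n y.
Proof.
move=> sy; have t0 (j : nat) : 2 ^+ j != 0 :> R by rewrite expf_neq0 ?pnatr_eq0.
have shift k : sin (y / 2 + pi *+ k) != 0.
  by rewrite (alternatingn (@sinDpi R)) mulf_eq0 signr_eq0.
elim: m => [|m IHm].
  by rewrite expn0 big_nat1 !expr0 divr1 mulr0 mul0r addr0 mul1r.
rewrite expnS mul2n -addnn (big_cat_nat (n := 2 ^ m)) ?leq_addr //=.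
rewrite -{2}[(2 ^ m)%N]add0n big_addn addnK -big_split /= [in RHS]exprS -mulrA -IHm.
rewrite mulr_sumr; apply: eq_bigr => k _.
(* The indices [k] and [k + 2 ^ m] give arguments that differ by pi, ready for [cotsum_dup]. *)
have -> : (y + 2 * (k + 2 ^ m)%:R * pi) / 2 ^+ m.+1 =
    (y + 2 * k%:R * pi) / 2 ^+ m.+1 + pi.
  by rewrite natrD natrX exprS; field; rewrite t0.
rewrite cotsum_dup; last first.
  have -> : (y + 2 * k%:R * pi) / 2 ^+ m.+1 = (y / 2 + pi *+ k) / 2 ^+ m.
    by rewrite exprS -[pi *+ k]mulr_natr; field; rewrite t0.
  exact: sin_div2X_neq0.
by congr (_ * cotsum n _); rewrite exprS; field; rewrite t0.
Qed.

(** By periodicity the upper half of the indices is moved down by 2^(m+1), to -2^m, ..., -1. The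
    window thus grows on both sides of 0, as needed to reach the whole lattice in the limit. *)
Lemma cotsum_distr_sym (R : realType) n m (y : R) : sin (y / 2) != 0 ->
  \sum_(0 <= k < 2 ^ m)
    (cotsum n ((2 * (Posz k)%:~R * pi + y) / 2 ^+ m.+1) +
     cotsum n ((2 * (Negz k)%:~R * pi + y) / 2 ^+ m.+1)) =
  (2 ^+ n.+1) ^+ m.+1 * cotsum n y.
Proof.
move=> sy; have t0 (j : nat) : 2 ^+ j != 0 :> R by rewrite expf_neq0 ?pnatr_eq0.
rewrite -cotsum_distr // [in RHS]expnS mul2n -addnn.
rewrite [RHS](big_cat_nat (n := 2 ^ m)) ?leq_addr //= big_split /=.
congr (_ + _).
  by apply: eq_bigr => k _; congr (cotsum n (_ / _)); rewrite addrC.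
rewrite -{2}[(2 ^ m)%N]add0n [RHS]big_addn addnK [RHS]big_nat_rev /= add0n.
apply: eq_big_nat => k /andP[_ lk].
rewrite -cotsum_periodic; congr (cotsum n _).
rewrite natrD natrB // natrX NegzE mulrNz -pmulrn exprS; field; by rewrite t0.
Qed.

(** * Passage to the limit *)

Lemma is_cvg_series_invsqr (R : realType) :
  cvgn (series (fun k => (k.+1%:R ^+ 2)^-1 : R)).
Proof.
apply: nondecreasing_is_cvgn.
  by apply: nondecreasing_series => k _ _; rewrite invr_ge0 exprn_ge0.
exists 2 => _ [n _ <-]; rewrite seriesEnat /=.
(* Telescoping majorant: 1/t^2 <= 2/t - 2/(t+1) for t >= 1. *)
suff: \sum_(0 <= k < n) (k.+1%:R ^+ 2)^-1 <= 2 - 2 / n.+1%:R :> R.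
  by move/le_trans; apply; rewrite gerBl divr_ge0.
elim: n => [|n IHn]; first by rewrite big_geq // divr1 subrr.
rewrite big_nat_recr //=; apply: le_trans (lerD IHn (lexx _)) _.
have n0 : 0 < n.+1%:R :> R by rewrite ltr0n.
have -> : n.+2%:R = n.+1%:R + 1 :> R by rewrite -[n.+2]addn1 natrD.
have n1 : 1 <= n.+1%:R :> R by rewrite ler1n.
move: n.+1%:R n0 n1 => t t0 t1.
rewrite -subr_ge0.
have -> : 2 - 2 / (t + 1) - (2 - 2 / t + (t ^+ 2)^-1) =
   (t - 1) / (t ^+ 2 * (t + 1)) by field; rewrite (gt_eqF t0) gt_eqF ?addr_gt0.
by rewrite divr_ge0 ?subr_ge0 // mulr_ge0 ?exprn_ge0 ?addr_ge0 // ltW.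
Qed.

(** Tannery's theorem for finite sums of constant value [L]: the distance from [L] to the first [J]
    terms is a tail in [k], at most a tail of the series of [M], uniformly in [m]; then [m] tends to
    infinity with [J] fixed. *)
Lemma tannery_cst (R : realType) (u : nat -> R ^nat) (v M : R ^nat)
    (K : nat -> nat) (L : R) :
  K @ \oo --> \oo -> (forall k, u m k @[m --> \oo] --> v k) ->
  (\forall m \near \oo, forall k, (k < K m)%N -> `|u m k| <= M k) ->
  cvgn (series M) -> (forall m, \sum_(0 <= k < K m) u m k = L) ->
  series v @ \oo --> L.
Proof.
move=> Koo uv uM cM uL; apply/cvgrPdist_le => e e0.
have /cauchy_cvgP/cauchy_seriesP/(_ e e0) [[A B] /= [[a _ aA] [b _ bB]] AB] := cM.
near=> J.
have cu : `|L - \sum_(0 <= k < J) u m k| @[m --> \oo] --> `|L - series v J|.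
  apply: cvg_norm; apply: cvgB; first exact: cvg_cst.
  rewrite seriesEnat; apply: cvg_big => [|k _]; last exact: uv.
  exact: add_continuous.
apply: (cvgr_to_le cu); near=> m.
have JK : (J <= K m)%N by near: m; exact: (Koo [set n | (J <= n)%N] (nbhs_infty_ge J)).
have bK : (b <= K m)%N by near: m; exact: (Koo [set n | (b <= n)%N] (nbhs_infty_ge b)).
rewrite -(uL m) (big_cat_nat (n := J)) //= addrAC subrr add0r.
apply: le_trans (ler_norm_sum _ _ _) _.
apply: (@le_trans _ _ (\sum_(J <= k < K m) M k)).
  apply: ler_sum_nat => k /andP[_ kK]; move: k kK; near: m; exact: uM.
apply: le_trans (ler_norm _) (ltW _); apply: (AB (J, K m)); split => /=.
  by apply: aA; near: J; exists a.
by apply: bB.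
Unshelve. all: by end_near. Qed.

(** * Bounds for the sine and for [cotsum] *)

Lemma sin_MVT (R : realType) (x : R) : 0 < x ->
  exists2 c, 0 < c < x & sin x = cos c * x.
Proof.
move=> x0; have [|c] := @MVT R sin cos 0 x x0 (fun t _ => is_derive_sin t).
  exact/continuous_subspaceT/continuous_sin.
by rewrite in_itv /= sin0 !subr0 => c0 ->; exists c.
Qed.

Lemma normr_sin_le (R : realType) (x : R) : `|sin x| <= `|x|.
Proof.
wlog x0 : x / 0 <= x => [hw|].
  have [/hw //|x0] := leP 0 x.
  by rewrite -(normrN (sin x)) -sinN -(normrN x); apply: hw; rewrite oppr_ge0 ltW.
move: x0; rewrite le_eqVlt => /predU1P[<-|x0]; first by rewrite sin0.
have [c _ ->] := sin_MVT _ _ x0.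
by rewrite normrM ler_piMl // cos_max.
Qed.

(** The range must exceed pi/2, since the arguments in [sin_lower_bound] may slightly pass it. The
    mean value theorem is therefore applied to x/2: sin x = cos(x/2) cos(c) x, with both cosines at
    least cos(3 pi/8). *)
Lemma normr_sin_ge (R : realType) (x : R) : `|x| <= 3 / 4 * pi ->
  cos (3 / 8 * pi) ^+ 2 * `|x| <= `|sin x|.
Proof.
wlog x0 : x / 0 <= x => [hw|].
  have [/hw //|x0] := leP 0 x.
  by rewrite -(normrN (sin x)) -sinN -(normrN x); apply: hw; rewrite oppr_ge0 ltW.
rewrite (ger0_norm x0) => x1.
move: x0; rewrite le_eqVlt => /predU1P[<-|x0]; first by rewrite mulr0.
have pi0 := pi_gt0 R.
have h0 : 0 < x / 2 by lra.
have [c /andP[c0 cx] sE] := sin_MVT _ _ h0.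
have cosle (a b : R) : 0 <= a -> a <= b -> b <= pi -> cos b <= cos a.
  move=> a0 ab b1; rewrite leNgt ltr_cos -?leNgt // in_itv /=; lra.
have C0 : 0 < cos (3 / 8 * pi : R) by apply: cos_gt0_pihalf; lra.
have C1 : cos (3 / 8 * pi) <= cos (x / 2) by apply: cosle; lra.
have C2 : cos (x / 2) <= cos c by apply: cosle; lra.
apply: le_trans (ler_norm _).
have -> : sin x = sin (x / 2 *+ 2) by rewrite -[_ *+ 2]mulr_natr divfK.
rewrite sin_mulr2n sE -[_ *+ 2]mulr_natr.
have -> : cos (x / 2) * (cos c * (x / 2)) * 2 = cos (x / 2) * cos c * x by field.
rewrite ler_pM2r // expr2 ler_pM // ?(le_trans C1) // ltW //.
Qed.

(** Bounding every cosine by 1 leaves the sum of the [Abar], which cancels the factorial. *)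
Lemma normr_cotsum_le (R : realType) n (y : R) :
  `|cotsum n y| <= (2 * `|sin (y / 2)|) ^- n.+1.
Proof.
rewrite /cotsum normrM div1r normfV !normrM !normrX !normr_nat.
apply: (@le_trans _ _ ((2 ^+ n.+1 * n`!%:R * `|sin (y / 2)| ^+ n.+1)^-1 * n`!%:R)).
  apply: ler_wpM2l; first by rewrite invr_ge0 !mulr_ge0 // exprn_ge0.
  apply: le_trans (ler_norm_sum _ _ _) _; rewrite -sum_Abar; apply: ler_sum => l _.
  by rewrite normrM normr_nat ler_piMl // cos_max.
rewrite exprMn mulrAC [in X in X <= _]invfM -mulrA mulVf ?mulr1 //.
Qed.

Lemma ex_linear_lower_bound (R : realFieldType) (f : nat -> R) :
  (forall k, 0 < f k) -> (\forall k \near \oo, k.+1%:R <= f k) ->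
  exists2 c, 0 < c & forall k, c * k.+1%:R <= f k.
Proof.
move=> f0 [K _ fK].
suff [c /andP[c0 c1] cf] : exists2 c, 0 < c <= 1 &
    forall k, (k < K)%N -> c * k.+1%:R <= f k.
  exists c => // k; have [/cf //|/fK /=] := ltnP k K.
  by apply: le_trans; rewrite ler_piMl.
elim: K {fK} => [|K [c /andP[c0 c1] cf]]; first by exists 1; rewrite ?ltr01 /=.
exists (Num.min c (f K / K.+1%:R)).
  by rewrite lt_min c0 divr_gt0 //= ge_min c1.
move=> k; rewrite ltnS leq_eqVlt => /predU1P[->|/cf cfk].
  by rewrite -ler_pdivlMr // ge_min lexx orbT.
by apply: le_trans cfk; rewrite ler_pM2r // ge_min lexx.
Qed.

Lemma normr_sinDpi (R : realType) (k : int) (x : R) :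
  `|sin (x + k%:~R * pi)| = `|sin x|.
Proof.
have shift (j : nat) (z : R) : `|sin (z + j%:R * pi)| = `|sin z|.
  by rewrite mulr_natl (alternatingn (@sinDpi R)) normrMsign.
case: k => j; first exact: shift.
by rewrite NegzE mulrNz -pmulrn -(shift j.+1) mulNr subrK.
Qed.

Lemma sin_half_neq0_int (R : realType) (a : R) :
  (forall k : int, a <> 2 * k%:~R * pi) -> sin (a / 2) != 0.
Proof.
move=> ha; have pi0 := pi_gt0 R; set k := Num.floor (a / (2 * pi)).
have /andP[] := real_floor_itv (num_real (a / (2 * pi))).
rewrite -/k ler_pdivlMr ?ltr_pdivrMr ?mulr_gt0 // intrD => ka ak.
rewrite -normr_gt0.
have -> : a / 2 = (a / 2 - k%:~R * pi) + k%:~R * pi by rewrite subrK.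
rewrite normr_sinDpi normr_gt0 gt_eqF // sin_gt0_pi //.
have {}ka : k%:~R * (2 * pi) < a.
  rewrite lt_neqAle ka andbT; apply/eqP=> e; apply: (ha k).
  by rewrite -e mulrCA mulrA.
by apply/andP; split; lra.
Qed.

(** * Behaviour of [cotsum] at its pole 0 *)

Lemma cvg_sin_half_div (R : realType) :
  h^-1 * sin (h / 2) @[h --> (0 : R)^'] --> (2^-1 : R).
Proof.
have dhalf : is_derive (0 : R) 1 (sin \o (fun x => 2^-1 * x))
      (cos (2^-1 * 0) * 2^-1).
  by apply: is_derive1_comp; apply: is_derive_eq; rewrite scaler1.
have [d] := dhalf; rewrite /derivable in d; rewrite /derive mulr0 cos0 mul1r => e.
rewrite -[X in _ --> X]e; apply: cvg_trans d; apply: near_eq_cvg.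
near=> h; rewrite /= mulr0 sin0 subr0 /GRing.scale /= mulr1 addr0.
by rewrite mulrC [_ / 2]mulrC [RHS]mulrC.
Unshelve. all: by end_near. Qed.

(** At 0 the cosine sum tends to n! by [sum_Abar], and 2 sin(h/2) is equivalent to h. *)
Lemma cvg_cotsum0 (R : realType) n :
  cotsum n h * h ^+ n.+1 @[h --> (0 : R)^'] --> (1 : R).
Proof.
have c1 : \sum_(l < n.+1) cos ((n.+1%:R / 2 - l%:R) * h) * (Abar n.+1 l)%:R
    @[h --> (0 : R)^'] --> (n`!%:R : R).
  rewrite -sum_Abar; apply: cvg_big => [|l _]; first exact: add_continuous.
  rewrite -[X in _ --> X]mul1r; apply: cvgMr_tmp.
  move: (_ / 2 - _) => c.
  rewrite -[X in _ --> X](cos0 R) -[X in _ --> cos X](mulr0 c).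
  apply: (@cvg_comp _ _ _ (fun h => c * h) cos); last exact: continuous_cos.
  by apply: cvgMl_tmp; exact: cvg_within.
have c2 : 2 * (h^-1 * sin (h / 2)) @[h --> (0 : R)^'] --> (1 : R).
  rewrite -[X in _ --> X](mulfV (x := 2)) ?pnatr_eq0 //.
  by apply: cvgMl_tmp; exact: cvg_sin_half_div.
have {}c2 : (2 * (h^-1 * sin (h / 2)))^-1 @[h --> (0 : R)^'] --> (1 : R).
  by rewrite -[X in _ --> X]invr1; apply: cvgV; first exact: oner_neq0.
have {}c2 : (2 * (h^-1 * sin (h / 2)))^-1 ^+ n.+1 @[h --> (0 : R)^'] --> (1 : R).
  rewrite -[X in _ --> X](expr1n _ n.+1).
  apply: (@cvg_comp _ _ _ _ (fun x : R => x ^+ n.+1) _ _ _ c2).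
  exact: exprn_continuous.
have f0 : n`!%:R != 0 :> R by rewrite pnatr_eq0 -lt0n fact_gt0.
have lim1 : n`!%:R^-1 * (2 * (h^-1 * sin (h / 2)))^-1 ^+ n.+1 *
    (\sum_(l < n.+1) cos ((n.+1%:R / 2 - l%:R) * h) * (Abar n.+1 l)%:R)
    @[h --> (0 : R)^'] --> (1 : R).
  have e : 1 = n`!%:R^-1 * 1 * n`!%:R :> R by rewrite mulr1 mulVf.
  rewrite [X in _ --> X]e.
  by apply: cvgM c1; apply: cvgMl_tmp.
apply: cvg_trans lim1; apply: near_eq_cvg; near=> h.
have h0 : h != 0 by near: h; exact: nbhs_dnbhs_neq.
rewrite /cotsum div1r !invfM invrK !exprMn !exprVn; ring.
Unshelve. all: by end_near. Qed.

Lemma cvg_cotsum_scale (R : realType) n (x : R) : x != 0 ->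
  cotsum n (x / 2 ^+ m.+1) / (2 ^+ n.+1) ^+ m.+1 @[m --> \oo] --> 1 / x ^+ n.+1.
Proof.
move=> x0.
have c : x / 2 ^+ m.+1 @[m --> \oo] --> (0 : R)^'.
  have c0 : x / 2 ^+ m.+1 @[m --> \oo] --> 0.
    rewrite -[X in _ --> X](mulr0 x); apply: cvgMl_tmp.
    under eq_cvg do rewrite -exprVn.
    have h : (fun m => 2^-1 ^+ m : R) @ \oo --> (0 : R).
      by apply: cvg_expr; rewrite ger0_norm // invf_lt1 // ltr1n.
    by rewrite -cvg_shiftS in h.
  move=> A A0; change (\forall m \near \oo, A (x / 2 ^+ m.+1)).
  have : \forall m \near \oo, x / 2 ^+ m.+1 != 0 -> A (x / 2 ^+ m.+1) := c0 _ A0.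
  apply: filterS => m; apply.
  by rewrite mulf_neq0 // invr_eq0 expf_neq0 // pnatr_eq0.
have lim1 : 1 / x ^+ n.+1 * (cotsum n (x / 2 ^+ m.+1) * (x / 2 ^+ m.+1) ^+ n.+1)
    @[m --> \oo] --> 1 / x ^+ n.+1.
  rewrite -[X in _ --> X]mulr1; apply: cvgMl_tmp.
  exact: (@cvg_comp _ _ _ _ _ _ _ _ c (@cvg_cotsum0 R n)).
apply: cvg_trans lim1; apply: near_eq_cvg; near=> m => /=.
have t0 : 2 ^+ m.+1 != 0 :> R by rewrite expf_neq0 ?pnatr_eq0.
rewrite [in RHS]exprAC; move: (2 ^+ m.+1) t0 => t t0.
rewrite expr_div_n div1r mulrCA; congr (_ * _).
by rewrite mulrA mulVf ?mul1r // expf_neq0.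
Unshelve. all: by end_near. Qed.

(** * Domination of the rescaled terms *)

Local Notation pt a k := (2 * k%:~R * pi + a).

Lemma sin_lower_bound (R : realType) (a : R) :
  (forall k : int, a <> 2 * k%:~R * pi) ->
  exists2 q : R, 0 < q & \forall m \near \oo, forall k, (k < 2 ^ m)%N ->
    q * k.+1%:R <= 2 ^+ m.+2 * `|sin ((pt a (Posz k)) / 2 ^+ m.+1 / 2)|
    /\ q * k.+1%:R <= 2 ^+ m.+2 * `|sin ((pt a (Negz k)) / 2 ^+ m.+1 / 2)|.
Proof.
move=> ha; have pi2 := pi_ge2 R.
pose x (k : int) : R := pt a k.
have x0 k : 0 < `|x k|.
  rewrite normr_gt0; apply/eqP=> xk; apply: (ha (- k)).
  by apply/eqP; rewrite -subr_eq0 -xk /x mulrNz; apply/eqP; ring.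
have [c c0 cx] : exists2 c : R, 0 < c &
    forall k : nat, c * k.+1%:R <= Num.min `|x (Posz k)| `|x (Negz k)|.
  apply: ex_linear_lower_bound => [k|]; first by rewrite lt_min !x0.
  near=> k.
  have ak : `|a| + 1 <= k%:R by near: k; exact: nbhs_infty_ger.
  have k0 : 0 <= k%:R :> R by [].
  have kpi : k%:R * 2 <= k%:R * pi :> R by rewrite ler_wpM2l.
  have := ler_norm a; have := ler_norm (- a); rewrite normrN => a1 a2.
  have k1 : k.+1%:R = k%:R + 1 :> R by rewrite -natr1.
  rewrite le_min; apply/andP; split.
    apply: le_trans (ler_norm _); rewrite /x -pmulrn k1 -mulrA; lra.
  rewrite -normrN; apply: le_trans (ler_norm _).
  rewrite /x NegzE mulrNz -pmulrn mulrN mulNr -mulrA k1 mulrDl; lra.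
set s : R := cos (3 / 8 * pi) ^+ 2.
have s0 : 0 < s by rewrite exprn_gt0 // cos_gt0_pihalf //; apply/andP; split; lra.
exists (s * c); first exact: mulr_gt0.
near=> m => k km.
have t0 : 0 < 2 ^+ m :> R by rewrite exprn_gt0.
(* This keeps the arguments, at most (2 * 2^m * pi + |a|) / 2^(m+2) in absolute value, within the
   range 3/4 pi of [normr_sin_ge]. *)
have am : `|a| <= 2 ^+ m.
  apply: (@le_trans _ _ m%:R); first by near: m; exact: nbhs_infty_ger.
  by rewrite -natrX ler_nat ltnW // ltn_expl.
have km' : k.+1%:R <= 2 ^+ m :> R by rewrite -natrX ler_nat.
have main y : `|y| <= 2 * 2 ^+ m * pi + `|a| -> c * k.+1%:R <= `|y| ->
    s * c * k.+1%:R <= 2 ^+ m.+2 * `|sin (y / 2 ^+ m.+1 / 2)|.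
  move=> y1 y2.
  have -> : y / 2 ^+ m.+1 / 2 = y / 2 ^+ m.+2.
    by rewrite -mulrA -invfM -exprSr.
  have T0 : 0 < 2 ^+ m.+2 :> R by rewrite exprn_gt0.
  have := @normr_sin_ge _ (y / 2 ^+ m.+2).
  rewrite normrM normfV (ger0_norm (ltW T0)) ler_pdivrMr //.
  have y3 : `|y| <= 3 / 4 * pi * 2 ^+ m.+2.
    apply: le_trans y1 _; rewrite !exprS.
    have : 2 ^+ m * 2 <= 2 ^+ m * pi :> R by rewrite ler_wpM2l // ltW.
    lra.
  move=> /(_ y3); rewrite -/s mulrA ler_pdivrMr // [_ * 2 ^+ _]mulrC.
  by apply: le_trans; rewrite -mulrA ler_wpM2l // ltW.
have kpi (j : nat) : (j <= k.+1)%N -> `|2 * j%:R * pi| <= 2 * 2 ^+ m * pi :> R.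
  move=> jk; rewrite ger0_norm ?mulr_ge0 ?pi_ge0 //.
  rewrite ler_wpM2r ?pi_ge0 // ler_wpM2l //.
  by apply: le_trans km'; rewrite ler_nat.
have := cx k; rewrite le_min => /andP[cx1 cx2].
split; apply: main => //; apply: le_trans (ler_normD _ _) _; rewrite lerD2r.
  by rewrite -pmulrn kpi.
by rewrite NegzE mulrNz -pmulrn mulrN mulNr normrN kpi.
Unshelve. all: by end_near. Qed.

(** The exponent is at least 2 here, so the terms are dominated one by one, without pairing. *)
Lemma cotsum_dominated (R : realType) n (a : R) :
  (forall k : int, a <> 2 * k%:~R * pi) ->
  exists C : R, \forall m \near \oo, forall k, (k < 2 ^ m)%N ->
    `|cotsum n.+1 ((pt a (Posz k)) / 2 ^+ m.+1) / (2 ^+ n.+2) ^+ m.+1|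
      <= C * (k.+1%:R ^+ 2)^-1 /\
    `|cotsum n.+1 ((pt a (Negz k)) / 2 ^+ m.+1) / (2 ^+ n.+2) ^+ m.+1|
      <= C * (k.+1%:R ^+ 2)^-1.
Proof.
move=> /sin_lower_bound[q q0 qs]; exists (q ^- n.+2).
near=> m => k km.
have main y : q * k.+1%:R <= 2 ^+ m.+2 * `|sin (y / 2)| ->
    `|cotsum n.+1 y / (2 ^+ n.+2) ^+ m.+1| <= q ^- n.+2 * (k.+1%:R ^+ 2)^-1.
  move=> qy; have t0 : 0 < 2 ^+ m.+1 :> R by rewrite exprn_gt0.
  have k0 : 0 < k.+1%:R :> R by rewrite ltr0n.
  have qk0 : 0 < q * k.+1%:R by rewrite mulr_gt0.
  rewrite exprAC normrM normfV normrX (ger0_norm (ltW t0)).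
  apply: le_trans (ler_wpM2r _ (normr_cotsum_le _ _ _)) _.
    by rewrite invr_ge0 exprn_ge0 // ltW.
  rewrite -invfM -exprMn mulrAC [_ * 2 ^+ _]mulrC -exprSr.
  apply: (@le_trans _ _ ((q * k.+1%:R) ^- n.+2)).
    rewrite lef_pV2 ?posrE ?exprn_gt0 //; last exact: lt_le_trans qy.
    by rewrite lerXn2r // nnegrE ?(ltW qk0) // (le_trans (ltW qk0)).
  rewrite exprMn invfM ler_pM2l ?invr_gt0 ?exprn_gt0 //.
  by rewrite lef_pV2 ?posrE ?exprn_gt0 // ler_weXn2l // ler1n.
have [q1 q2] : q * k.+1%:R <= 2 ^+ m.+2 * `|sin ((pt a (Posz k)) / 2 ^+ m.+1 / 2)|
    /\ q * k.+1%:R <= 2 ^+ m.+2 * `|sin ((pt a (Negz k)) / 2 ^+ m.+1 / 2)|.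
  by move: k km {main}; near: m.
by split; apply: main.
Unshelve. all: by end_near. Qed.

Lemma cotsum_pair_dominated (R : realType) n (a : R) :
  (forall k : int, a <> 2 * k%:~R * pi) ->
  exists C : R, \forall m \near \oo, forall k, (k < 2 ^ m)%N ->
    `|(cotsum n ((pt a (Posz k)) / 2 ^+ m.+1) +
       cotsum n ((pt a (Negz k)) / 2 ^+ m.+1)) / (2 ^+ n.+1) ^+ m.+1|
      <= C * (k.+1%:R ^+ 2)^-1.
Proof.
case: n => [|n] ha; last first.
  have [C hC] := @cotsum_dominated R n a ha; exists (C + C).
  apply: filterS hC => m h k /h[h1 h2].
  rewrite [X in `|X|]mulrDl [(C + C) * _]mulrDl.
  by apply: le_trans (ler_normD _ _) _; apply: lerD.
have [q q0 qs] := sin_lower_bound _ _ ha; exists (`|2 * a - 2 * pi| / q ^+ 2).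
near=> m => k km.
have : q * k.+1%:R <= 2 ^+ m.+2 * `|sin ((pt a (Posz k)) / 2 ^+ m.+1 / 2)|
    /\ q * k.+1%:R <= 2 ^+ m.+2 * `|sin ((pt a (Negz k)) / 2 ^+ m.+1 / 2)|.
  by move: k km; near: m.
rewrite !cotsum0.
set w := _ / 2 ^+ m.+1 / 2; set w' := _ / 2 ^+ m.+1 / 2 => -[h1 h2].
have t0 : 0 < 2 ^+ m.+1 :> R by rewrite exprn_gt0.
have T0 : 0 < 2 ^+ m.+2 :> R by rewrite exprn_gt0.
have qk0 : 0 < q * k.+1%:R by rewrite mulr_gt0.
have sw : sin w != 0.
  by rewrite -normr_gt0 -(pmulr_rgt0 _ T0); exact: lt_le_trans qk0 h1.
have sw' : sin w' != 0.
  by rewrite -normr_gt0 -(pmulr_rgt0 _ T0); exact: lt_le_trans qk0 h2.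
(* cot w + cot w' = sin(w + w') / (sin w sin w'), where w + w' = (2a - 2 pi) / 2^(m+2) does not
   depend on [k]: the numerator stays bounded and the two sines give the square of [k.+1]. *)
have -> : (1 / 2 * cot w + 1 / 2 * cot w') / (2 ^+ 1) ^+ m.+1 =
    2 ^+ m.+2 * sin (w + w') / (2 ^+ m.+2 * sin w * (2 ^+ m.+2 * sin w')).
  rewrite sinD /cot expr1 (exprS _ m.+1); field.
  by rewrite sw sw' (gt_eqF t0).
have TE : 2 ^+ m.+2 = 2 * 2 ^+ m.+1 :> R by rewrite exprS.
move: (2 ^+ m.+2) TE T0 h1 h2 => T TE T0 h1 h2.
rewrite normrM normfV !normrM (ger0_norm (ltW T0)).
have ww : T * `|sin (w + w')| <= `|2 * a - 2 * pi|.
  apply: le_trans (ler_wpM2l (ltW T0) (normr_sin_le _ _)) _.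
  rewrite -{1}(ger0_norm (ltW T0)) -normrM.
  suff -> : T * (w + w') = 2 * a - 2 * pi by [].
  rewrite /w /w' NegzE mulrNz -!pmulrn -natr1 TE; field.
  by rewrite (gt_eqF t0).
rewrite -[leRHS]mulrA -invfM -exprMn; apply: ler_pM => //.
- by rewrite mulr_ge0 // ltW.
- by rewrite invr_ge0 !mulr_ge0 // ltW.
rewrite lef_pV2 ?posrE; last 2 first.
- by apply: mulr_gt0; exact: lt_le_trans qk0 _.
- exact: exprn_gt0.
by rewrite expr2; apply: ler_pM => //; apply: ltW.
Unshelve. all: by end_near. Qed.

(** * Summation over the lattice *)

Lemma cvg_expn2 : (fun m => 2 ^ m)%N @ \oo --> \oo.
Proof.
move=> A [N _ NA]; exists N => // m /= Nm; apply: NA => /=.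
by apply: leq_trans Nm _; rewrite ltnW // ltn_expl.
Qed.

Lemma lattice_neq0 (R : realType) (a : R) (k : int) :
  (forall k : int, a <> 2 * k%:~R * pi) -> 2 * k%:~R * pi + a != 0.
Proof.
move=> ha; apply/eqP=> xk; apply: (ha (- k)).
by apply/eqP; rewrite -subr_eq0 -xk mulrNz; apply/eqP; ring.
Qed.

Lemma cvg_series_cotsum (R : realType) n (a : R) :
  (forall k : int, a <> 2 * k%:~R * pi) ->
  series (fun k => 1 / (pt a (Posz k)) ^+ n.+1 +
                   1 / (pt a (Negz k)) ^+ n.+1) @ \oo --> cotsum n a.
Proof.
move=> ha; have [C hC] := @cotsum_pair_dominated R n a ha.
pose u m k := (cotsum n ((pt a (Posz k)) / 2 ^+ m.+1) +
     cotsum n ((pt a (Negz k)) / 2 ^+ m.+1)) / (2 ^+ n.+1) ^+ m.+1.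
apply: (@tannery_cst R u _ (fun k => C * (k.+1%:R ^+ 2)^-1) (expn 2)) => //.
- exact: cvg_expn2.
- move=> k; rewrite /u; under eq_cvg do rewrite mulrDl.
  by apply: cvgD; apply: cvg_cotsum_scale; apply: lattice_neq0.
- have -> : (fun k => C * (k.+1%:R ^+ 2)^-1) =
      C *: (fun k => (k.+1%:R ^+ 2)^-1 : R).
    by [].
  by apply: is_cvg_seriesZ; exact: is_cvg_series_invsqr.
- move=> m; rewrite -mulr_suml cotsum_distr_sym; last exact: sin_half_neq0_int.
  by rewrite mulrAC mulfV ?mul1r // !expf_neq0 ?pnatr_eq0.
Qed.

Lemma is_cvg_series_lattice (R : realType) n (a : R) :
  (forall k : int, a <> 2 * k%:~R * pi) ->
  cvgn (series (fun k => 1 / (pt a (Posz k)) ^+ n.+2)) /\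
  cvgn (series (fun k => 1 / (pt a (Negz k)) ^+ n.+2)).
Proof.
move=> ha; have [C hC] := @cotsum_dominated R n a ha.
have cC : cvgn (series (fun k => `|C| * (k.+1%:R ^+ 2)^-1)).
  have -> : (fun k => `|C| * (k.+1%:R ^+ 2)^-1) =
      `|C| *: (fun k => (k.+1%:R ^+ 2)^-1 : R).
    by [].
  apply: is_cvg_seriesZ; exact: is_cvg_series_invsqr.
(* The bound passes to the limit [m --> \oo]. *)
have main (x : nat -> R) : (forall k, x k != 0) ->
    (forall k, \forall m \near \oo,
      `|cotsum n.+1 (x k / 2 ^+ m.+1) / (2 ^+ n.+2) ^+ m.+1| <= C * (k.+1%:R ^+ 2)^-1) ->
    cvgn (series (fun k => 1 / x k ^+ n.+2)).
  move=> x0 xC; apply: normed_cvg; apply: series_le_cvg cC => // k.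
    exact: normr_ge0.
  apply: (@le_trans _ _ (C * (k.+1%:R ^+ 2)^-1)).
    apply: (cvgr_to_le _ (xC k)).
    by apply: cvg_norm; exact: cvg_cotsum_scale.
  by rewrite ler_wpM2r ?ler_norm // invr_ge0 exprn_ge0.
have k2 (k : nat) : \forall m \near \oo, (k < 2 ^ m)%N.
  by apply: (cvg_expn2 [set j | (k < j)%N]); exists k.+1.
by split; apply: main => k; rewrite ?lattice_neq0 //; near=> m;
  have [] : _ /\ _ := (near hC m _) k (near (k2 k) m _).
Unshelve. all: by end_near. Qed.

(** [Negz k] is -(k+1), so the negative half has [M] terms and the nonnegative half, which contains
    0, has [N.+1]. *)
Lemma zpartial_sumE (R : realType) (f : int -> R) M N :
  zpartial_sum f M N =
  series (fun k => f (Posz k)) N.+1 + series (fun k => f (Negz k)) M.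
Proof.
rewrite /zpartial_sum !seriesEnat /= -addnS addrC.
rewrite (big_cat_nat (n := M)) ?leq_addr //=; congr (_ + _).
  rewrite big_nat_rev /= add0n; apply: eq_big_nat => k /andP[_ kM].
  by congr f; rewrite NegzE -subzn //; ring.
rewrite -{1}[M]add0n big_addn addKn; apply: eq_bigr => k _.
by congr f; rewrite PoszD addrK.
Qed.

Lemma cotsumE (R : realType) n (a : R) :
  cotsum n.+1 a = 1 / (2 ^+ n.+2 * n.+1`!%:R * sin (a / 2) ^+ n.+2) *
    \sum_(1 <= l < n.+2) cos ((n.+2%:R / 2 - l%:R) * a) * (Abar n.+2 l)%:R.
Proof.
rewrite /cotsum; congr (_ * _); rewrite -[LHS](big_mkord xpredT (fun l : nat =>
  cos ((n.+2%:R / 2 - l%:R) * a) * (Abar n.+2 l)%:R)).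
by rewrite big_ltn // AbarS mul0n mulr0 add0r.
Qed.

Lemma cvg_inv_lattice (R : realType) (a : R) :
  1 / (pt a (Posz k)) @[k --> \oo] --> (0 : R).
Proof.
have pi2 := pi_ge2 R.
apply: (@squeeze_cvgr _ _ _ _ (cst 0) harmonic); last 2 first.
- exact: cvg_cst.
- exact: cvg_harmonic.
near=> k.
have ak : `|a| + 1 <= k%:R by near: k; exact: nbhs_infty_ger.
have kpi : k%:R * 2 <= k%:R * pi :> R by rewrite ler_wpM2l.
have := ler_norm (- a); rewrite normrN => a1.
have k0 : 0 <= k%:R :> R by [].
have kx : k.+1%:R <= 2 * (Posz k)%:~R * pi + a.
  rewrite -pmulrn -natr1 -mulrA; lra.
have k1 : 0 < k.+1%:R :> R by rewrite ltr0n.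
have x0 := lt_le_trans k1 kx.
by rewrite /= div1r invr_ge0 (ltW x0) lef_pV2.
Unshelve. all: by end_near. Qed.

Theorem theorem2p4 (R : realType) (alpha : R)
    (halpha : forall k : int, alpha <> 2 * k%:~R * pi) :
  (forall n : nat, (2 <= n)%N ->
     zseries_cvg (fun k : int => 1 / (2 * k%:~R * pi + alpha) ^+ n)
       (1 / (2 ^+ n * (n.-1)`!%:R * sin (alpha / 2) ^+ n) *
        \sum_(1 <= l < n) cos ((n%:R / 2 - l%:R) * alpha) * (Abar n l)%:R)) /\
  zpartial_sum (fun k : int => 1 / (2 * k%:~R * pi + alpha)) N N
    @[N --> \oo] --> 1 / 2 * cot (alpha / 2).
Proof.
split=> [[|[|n]] // _|].
  rewrite -cotsumE /zseries_cvg.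
  have [cA cB] := @is_cvg_series_lattice R n alpha halpha.
  have := @cvg_series_cotsum R n.+1 alpha halpha.
  set A := series _ in cA; set B := series _ in cB => cAB.
  (* Both halves converge, so the limit of the paired series is the sum of their limits, and each
     half may then follow its own bound. *)
  have -> : cotsum n.+1 alpha = limn A + limn B.
    have {}cAB : (A + B) @ \oo --> cotsum n.+1 alpha by rewrite /A /B -seriesD.
    by rewrite -limD //; apply/esym/cvg_lim.
  under eq_cvg do rewrite zpartial_sumE.
  apply: cvgD.
    apply: (@cvg_comp _ _ _ snd (fun N => A N.+1)); first exact: cvg_snd.
    by rewrite cvg_shiftS.
  by apply: (@cvg_comp _ _ _ fst B); [exact: cvg_fst|exact: cB].
rewrite -cotsum0.
have := @cvg_series_cotsum R 0 alpha halpha.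
rewrite seriesD => cAB.
(* A symmetric sum has one more nonnegative index than negative ones; the unpaired term, at [N], is
   split off and tends to 0. *)
under eq_cvg do rewrite zpartial_sumE seriesSr addrAC.
rewrite -(addr0 (cotsum 0 alpha)); apply: cvgD; last exact: cvg_inv_lattice.
exact: cAB.
Qed.
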